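(* Let $n\ge1$, $\alpha=(\alpha_1,\dots,\alpha_n)\in(0,2]^n$, $\beta=(\beta_1,\dots,\beta_n)\in(0,\infty)^n$, and let $X^{\#}_{\alpha,\beta}(t)$, $t\in\mathbb{R}^n$, be the Gaussian sheet with generalized Cauchy covariance, i.e. the centered Gaussian field with covariance $\langle X^{\#}_{\alpha,\beta}(t+\tau)X^{\#}_{\alpha,\beta}(t)\rangle=\prod_{i=1}^n(1+|\tau_i|^{\alpha_i})^{-\beta_i}$. Then for every $t\in\mathbb{R}^n$, as $\varepsilon=(\varepsilon_1,\dots,\varepsilon_n)\to0^+$ (i.e. $\varepsilon_i\to0^+$ for all $i$), $$\left\{\frac{\square_{\varepsilon.u}X^{\#}_{\alpha,\beta}(t)}{\prod_{i=1}^n\varepsilon_i^{\alpha_i/2}}\right\}_{u\in\mathbb{R}^n}\longrightarrow\left\{\left[\prod_{i=1}^n\sqrt{2\beta_i}\right]B^{\#}_{\alpha/2}(u)\right\}_{u\in\mathbb{R}^n}$$ in the sense of finite-dimensional distributions, where $\varepsilon.u=\sum_{i=1}^n\varepsilon_iu_ie_i$.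
   Context: $\langle\cdot\rangle$ denotes expectation and $e_i$ is the unit vector in the $i$-th coordinate direction. The total increment by $u\in\mathbb{R}^n$ of a field $X$ at $t$ is $$\square_uX(t)=\sum_{\delta\in\{0,1\}^n}(-1)^{n-\sum_{i=1}^n\delta_i}X\Big(t+\sum_{i=1}^n\delta_iu_ie_i\Big).$$ The fractional Brownian sheet $B^{\#}_{\alpha/2}(t)$, $t\in\mathbb{R}^n$, of index $\alpha/2=(\alpha_1/2,\dots,\alpha_n/2)$ is the centered Gaussian field with covariance $\langle B^{\#}_{\alpha/2}(t)B^{\#}_{\alpha/2}(s)\rangle=\frac{1}{2^n}\prod_{i=1}^n\left(|t_i|^{\alpha_i}+|s_i|^{\alpha_i}-|t_i-s_i|^{\alpha_i}\right)$ (the same formula being used when some $\alpha_i=2$). *)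

(* Defs.v *)
From mathcomp Require Import all_boot all_order all_algebra.
From mathcomp Require Import all_classical all_reals all_analysis.
Set Implicit Arguments.
Unset Strict Implicit.
Unset Printing Implicit Defensive.
Import Order.TTheory GRing.Theory Num.Theory.
Import numFieldNormedType.Exports.
Local Open Scope classical_set_scope.
Local Open Scope ring_scope.

Section Increments.
Context {R : realType} {n : nat}.
Implicit Types t u eps : 'rV[R]_n.

Definition unit_vector (i : 'I_n) : 'rV[R]_n := delta_mx 0 i.

Definition total_increment (u : 'rV[R]_n) (f : 'rV[R]_n -> R) t : R :=
  \sum_(d : {ffun 'I_n -> bool})
     (-1) ^+ (n - \sum_(i < n) d i)
     * f (t + \sum_(i < n) ((d i)%:R * u 0 i) *: unit_vector i).

Definition coord_scale eps u : 'rV[R]_n :=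
  \sum_(i < n) (eps 0 i * u 0 i) *: unit_vector i.

(* eps --> 0^+: all coordinates tend to 0 through positive values *)
Definition zero_right : set_system 'rV[R]_n :=
  within [set eps : 'rV[R]_n | forall i, 0 < eps 0 i] (nbhs (0 : 'rV[R]_n)).

End Increments.

(* The case s = 0 is separated because normal_prob m 0 is the uniform law on
   [0, 1] in the library, not the Dirac mass at m. *)
Definition gaussian_law {R : realType} (m s : R) (A : set R) : \bar R :=
  if s == 0 then \d_m A else normal_prob m s A.

Section Fields.
Context {R : realType} {n : nat} {d : measure_display} {T : measurableType d}
  (P : probability T R).

Definition gaussian_rv (Y : T -> R) : Prop :=
  exists m s : R, 0 <= s /\
    forall A : set R, measurable A -> pushforward P Y A = gaussian_law m s A.

Definition gaussian_field (X : 'rV[R]_n -> {RV P >-> R}) : Prop :=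
  forall (k : nat) (c : 'I_k -> R) (t : 'I_k -> 'rV[R]_n),
    gaussian_rv (fun w => \sum_(j < k) c j * X (t j) w).

Definition centered (X : 'rV[R]_n -> {RV P >-> R}) : Prop :=
  forall t, ('E_P[X t] = 0)%E.

Definition cauchy_sheet (alpha beta : 'I_n -> R)
    (X : 'rV[R]_n -> {RV P >-> R}) : Prop :=
  [/\ gaussian_field X, centered X &
      forall t tau : 'rV[R]_n,
        'E_P[fun w => (X (t + tau) w * X t w)%R]%E =
        (\prod_(i < n) (1 + `|tau 0 i| `^ alpha i) `^ (- beta i))%:E].

(* The sheet of index alpha / 2. *)
Definition fractional_brownian_sheet (alpha : 'I_n -> R)
    (B : 'rV[R]_n -> {RV P >-> R}) : Prop :=
  [/\ gaussian_field B, centered B &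
      forall t s : 'rV[R]_n,
        'E_P[fun w => (B t w * B s w)%R]%E =
        ((2 ^+ n)^-1 *
         \prod_(i < n) (`|t 0 i| `^ alpha i + `|s 0 i| `^ alpha i
                        - `|t 0 i - s 0 i| `^ alpha i))%:E].

End Fields.

(* For each finite family u_1, ..., u_k of indices, the random vectors
   (Y e u_1, ..., Y e u_k) converge weakly to (Z u_1, ..., Z u_k) along F:
   expectations of bounded continuous functions converge. The limit Z may live
   on another probability space. *)
Definition cvg_fdd {R : realType} {d d' : measure_display}
    {T : measurableType d} {T' : measurableType d'}
    (P : probability T R) (P' : probability T' R) {I U : Type}
    (F : set_system I) (Y : I -> U -> T -> R) (Z : U -> T' -> R) : Prop :=
  forall (k : nat) (u : 'I_k -> U) (f : 'rV[R]_k -> R),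
    continuous f -> bounded_fun f ->
    'E_P[fun w => f (\row_(j < k) Y e (u j) w)]%E @[e --> F]
      --> 'E_P'[fun w => f (\row_(j < k) Z (u j) w)]%E.

(* Main.v *)
(** All the vectors involved are centered Gaussian, so the law of each is
    governed by its covariance. The covariance of the increments is a mixed
    second difference of a product kernel and factorises over the coordinates;
    each factor converges because [(1 - (1 + h) `^ (- b)) / h --> b].

    Passing from covariances to weak convergence needs neither a continuity
    theorem for characteristic functions nor tightness. A bounded continuous
    [f] lies within [e * (1 + |x|^2)] of a trigonometric polynomial [g],
    everywhere: take for [g x] the expectation of [f] at the end of a random
    walk whose mean step along [j] is proportional to [sin (w * x_j)]. The
    expectation of [g] at a centered Gaussian vector is a continuous function
    of the covariance, and the error is controlled by the second moments. *)

Require Import Defs.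
From mathcomp Require Import all_boot all_order all_algebra.
From mathcomp Require Import all_classical all_reals all_analysis.
From mathcomp Require Import measurable_realfun ring lra.
Set Implicit Arguments.
Unset Strict Implicit.
Unset Printing Implicit Defensive.
Import Order.TTheory GRing.Theory Num.Theory.
Import numFieldNormedType.Exports.
Local Open Scope classical_set_scope.
Local Open Scope ring_scope.

(** * Trigonometric polynomials and random walks *)

Section TrigPoly.
Context {R : realType} {k : nat}.
Implicit Types (f g : 'rV[R]_k -> R) (x y z : 'rV[R]_k).

(** The free phase [b] makes constants and sines instances of the one generator, so a single
    integral formula for cosines settles all trigonometric polynomials by induction. *)
Inductive trig_poly : ('rV[R]_k -> R) -> Prop :=
| TrigCos a b (c : 'I_k -> R) :
    trig_poly (fun x => a * cos (b + \sum_(j < k) c j * x 0 j))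
| TrigAdd f g : trig_poly f -> trig_poly g -> trig_poly (fun x => f x + g x).

Lemma trig_poly_cst a : trig_poly (fun=> a).
Proof.
rewrite (_ : (fun=> a) = fun x => a * cos (0 + \sum_(j < k) 0 * x 0 j)).
  exact: (TrigCos _ _ (fun=> 0)).
apply/funext => x; rewrite big1 ?addr0 ?cos0 ?mulr1// => j _.
by rewrite mul0r.
Qed.

Lemma cosM_half (u v : R) : cos u * cos v = (cos (u + v) + cos (u - v)) / 2.
Proof. by rewrite cosD cosB; field. Qed.

(** By the product-to-sum formula a product of two generators is a sum of two generators;
    distributivity does the rest. *)
Lemma trig_polyM f g : trig_poly f -> trig_poly g ->
  trig_poly (fun x => f x * g x).
Proof.
move=> hf; elim: hf g => [a b c|f1 f2 _ ih1 _ ih2] g hg; last first.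
  rewrite (_ : (fun x => _) = fun x => f1 x * g x + f2 x * g x).
    by apply: TrigAdd; [exact: ih1|exact: ih2].
  by apply/funext => x; rewrite mulrDl.
elim: hg => [a' b' c'|g1 g2 _ ih1 _ ih2]; last first.
  rewrite (_ : (fun x => _) = fun x =>
     a * cos (b + \sum_(j < k) c j * x 0 j) * g1 x +
     a * cos (b + \sum_(j < k) c j * x 0 j) * g2 x).
    exact: TrigAdd.
  by apply/funext => x; rewrite mulrDr.
rewrite (_ : (fun x => _) = fun x =>
    a * a' / 2 * cos ((b + b') + \sum_(j < k) (c j + c' j) * x 0 j) +
    a * a' / 2 * cos ((b - b') + \sum_(j < k) (c j - c' j) * x 0 j)).
  by apply: TrigAdd; [exact: (TrigCos _ _ (fun j => c j + c' j))
                     |exact: (TrigCos _ _ (fun j => c j - c' j))].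
apply/funext => x; rewrite mulrACA cosM_half -mulrDr mulrA.
rewrite -!mulrA; congr (_ * (_ * _)); rewrite mulrC; congr (_ * (cos _ + cos _)).
- rewrite addrACA -big_split/=; congr (_ + _).
  by apply: eq_bigr => j _; rewrite mulrDl.
- rewrite opprD addrACA -sumrN -big_split/=; congr (_ + _).
  by apply: eq_bigr => j _; rewrite mulrBl.
Qed.

Lemma trig_poly_sin w (j : 'I_k) : trig_poly (fun x => sin (w * x 0 j)).
Proof.
rewrite (_ : (fun x => _) = fun x => 1 * cos (- (pi / 2) +
    \sum_(i < k) (if i == j then w else 0) * x 0 i)).
  exact: (TrigCos _ _ (fun i => if i == j then w else 0)).
apply/funext => x; rewrite mul1r (bigD1 j)//= eqxx big1 => [|i /negbTE ->].
  by rewrite addr0 addrC cosBpihalf.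
by rewrite mul0r.
Qed.

End TrigPoly.

(** * Expectations at the end of a biased coordinate walk *)

Section Walk.
Context {R : realType} {k : nat}.
Implicit Types (s : 'I_k -> R) (F G : 'rV[R]_k -> R) (x y z : 'rV[R]_k).

(* Expectation of [F] at the end of a random walk from [y] whose successive
   independent steps are [+-h] along the coordinates listed in [js], a step
   along [j] being positive with probability [(1 + s j) / 2]. *)
Fixpoint walk s h (js : seq 'I_k) F y : R :=
  if js is j :: js' then
    (1 + s j) / 2 * walk s h js' F (y + h *: delta_mx 0 j) +
    (1 - s j) / 2 * walk s h js' F (y - h *: delta_mx 0 j)
  else F y.

(** Only the transition probabilities depend on [x]. The possible end points are fixed, so this is a
    finite combination of values of [F] whose weights are products of factors [(1 + sin) / 2] and
    [(1 - sin) / 2]. *)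
Lemma trig_poly_walk w h js F y :
  trig_poly (fun x => walk (fun j => sin (w * x 0 j)) h js F y).
Proof.
elim: js y => [|j js ih] y /=; first exact: trig_poly_cst.
apply: TrigAdd; apply: trig_polyM => //.
- rewrite (_ : (fun x => _) = fun x => 1 / 2 + 1 / 2 * sin (w * x 0 j)).
    apply: TrigAdd; first exact: trig_poly_cst.
    by apply: trig_polyM; [exact: trig_poly_cst|exact: trig_poly_sin].
  by apply/funext => x; field.
- rewrite (_ : (fun x => _) = fun x => 1 / 2 + - (1 / 2) * sin (w * x 0 j)).
    apply: TrigAdd; first exact: trig_poly_cst.
    by apply: trig_polyM; [exact: trig_poly_cst|exact: trig_poly_sin].
  by apply/funext => x; field.
Qed.

Lemma ler_walk s h js F G y : (forall j, `|s j| <= 1) ->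
  (forall z, F z <= G z) -> walk s h js F y <= walk s h js G y.
Proof.
move=> s1 FG; elim: js y => [|j js ih] y //=.
have := s1 j; rewrite ler_norml => /andP[s1l s1r].
by apply: lerD; apply: ler_wpM2l => //; apply: divr_ge0 => //; lra.
Qed.

Lemma walk_affine s h js F a b y :
  walk s h js (fun z => a + b * F z) y = a + b * walk s h js F y.
Proof. by elim: js y => [|j js ih] y //=; rewrite !ih; field. Qed.

Lemma walk_sum s h js (F : 'I_k -> 'rV[R]_k -> R) y :
  walk s h js (fun z => \sum_i F i z) y = \sum_i walk s h js (F i) y.
Proof.
elim: js y => [|j js ih] y //=; rewrite !ih !mulr_sumr -big_split/=.
exact: eq_bigr.
Qed.

(** Squared bias plus variance: coordinate [i] makes [count_mem i js] independent moves, each of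
    mean [h * s i] and variance [h ^+ 2 * (1 - s i ^+ 2)]. *)
Lemma walk_sqr s h js (i : 'I_k) a y :
  walk s h js (fun z => (z 0 i - a) ^+ 2) y =
  (y 0 i + h * (count_mem i js)%:R * s i - a) ^+ 2 +
  h ^+ 2 * (count_mem i js)%:R * (1 - s i ^+ 2).
Proof.
elim: js y => [|j js ih] y /=; first by rewrite !(mulr0, mul0r, addr0).
rewrite !ih !mxE/= eq_sym; have [->|_] := eqVneq i j.
  by rewrite /= add1n -natr1; field.
by rewrite /= add0n; field.
Qed.

(** The walk averages with nonnegative weights, so the quadratic bound on [F - L] may be averaged;
    [walk_sqr] evaluates the result, with the variance bounded by [h ^+ 2 * N%:R]. *)
Lemma walk_dist s h js N F x L e K : (forall j, `|s j| <= 1) ->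
  (forall i, count_mem i js = N) -> 0 <= K ->
  (forall z, `|F z - L| <= e + K * \sum_i (z 0 i - x 0 i) ^+ 2) ->
  `|walk s h js F 0 - L| <=
  e + K * \sum_i ((h * N%:R * s i - x 0 i) ^+ 2 + h ^+ 2 * N%:R).
Proof.
move=> s1 cN K0 FL.
set B := e + _.
have W : walk s h js (fun z => e + K * \sum_i (z 0 i - x 0 i) ^+ 2) 0 <= B.
  rewrite walk_affine walk_sum /B lerD2l ler_wpM2l//.
  apply: ler_sum => i _; rewrite walk_sqr cN mxE add0r lerD2l.
  by apply: ler_piMr; [rewrite mulr_ge0 ?sqr_ge0|rewrite gerBl sqr_ge0].
(* The weights have total mass 1, so [L] can be pulled out of the average; the factor 1 gives the
   integrand the shape of [walk_affine]. *)
have W1 : walk s h js (fun z => L + 1 * (F z - L)) 0 = walk s h js F 0.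
  by congr walk; apply/funext => z; ring.
rewrite walk_affine mul1r in W1.
rewrite -W1 addrAC subrr add0r ler_norml; apply/andP; split.
  rewrite lerNl -[leLHS]add0r -mulN1r -walk_affine (le_trans _ W)//.
  apply: ler_walk => // z; rewrite add0r mulN1r (le_trans _ (FL z))//.
  by rewrite -normrN ler_norm.
apply: le_trans W; apply: ler_walk => // z.
by rewrite (le_trans _ (FL z))// ler_norm.
Qed.

End Walk.

(** * Trigonometric approximation with a quadratic error *)

Section TrigApprox.
Context {R : realType}.

(** Mean value theorem: [sin v - v] vanishes at 0 and its derivative [cos v - 1] is small near 0.
    Negative [v] follow by oddness. *)
Lemma sin_near0 (eta : R) : 0 < eta ->
  exists2 del : R, 0 < del &
    forall v, `|v| < del -> `|sin v - v| <= eta * `|v|.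
Proof.
move=> eta0.
have /cvgrPdist_le/(_ _ eta0) : cos v @[v --> (0 : R)] --> cos 0.
  exact: continuous_cos.
move=> /nbhs_ballP[del /= del0 hdel]; exists del => //.
have pos v : 0 <= v -> v < del -> `|sin v - v| <= eta * `|v|.
  move=> v0 vd.
  have dg x : x \in `]0, v[ -> is_derive x 1 (fun y : R => sin y - y) (cos x - 1).
    by move=> _; apply: is_deriveB.
  have cg : {within `[0, v], continuous (fun y : R => sin y - y)}.
    apply: continuous_subspaceT => x.
    by apply: cvgB; [exact: continuous_sin|exact: cvg_id].
  have [c] := MVT_segment v0 dg cg.
  rewrite in_itv/= sin0 !subr0 => /andP[c0 cv] ->.
  rewrite normrM ler_wpM2r// distrC -cos0; apply: hdel.
  by rewrite /ball/= sub0r normrN ger0_norm// (le_lt_trans cv).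
move=> v vd; have [v0|v0] := leP 0 v; first by rewrite pos// (le_lt_trans _ vd)// ler_norm.
have := pos (- v); rewrite sinN -opprD !normrN; apply; first by rewrite oppr_ge0 ltW.
by rewrite -ltr0_norm.
Qed.

Context {k : nat}.
Implicit Types (f : 'rV[R]_k -> R) (x z : 'rV[R]_k).

(** Only [x] is confined to the cube, while [z] may leave it. Compactness of the cube, in its
    near-covering form with the radius as parameter, makes the local radii uniform. *)
Lemma near_unif_continuous f (rho e : R) : continuous f -> 0 < e ->
  exists2 eta : R, 0 < eta & forall x, (forall i, `|x 0 i| <= rho) ->
    forall z, (forall i, `|z 0 i - x 0 i| < eta) -> `|f z - f x| <= e.
Proof.
move=> cf e0.
have cC : compact [set x : 'rV[R]_k | forall i, x ord0 i \in `[- rho, rho]].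
  apply: (@rV_compact _ _ (fun=> `[- rho, rho]%classic)) => _.
  exact: segment_compact.
have /compact_near_coveringP cov := cC.
have := cov R (0 : R)^'+
  (fun eta x => forall z, ball x eta z -> `|f z - f x| <= e) _.
move=> /(_ _)[x Cx|/= eta eta0 /(_ (eta / 2))].
  have e20 : 0 < e / 2 by rewrite divr_gt0.
  have /cvgrPdist_le/(_ _ e20)/nbhs_ballP[r /= r0 hr] := cf x.
  (* Half of [r] is spent on moving the centre from [x] to [x'], half on going from [x'] to [z]. *)
  exists (ball x (r / 2), [set eta | eta < r / 2]).
    split => /=; first by apply: nbhsx_ballx; rewrite divr_gt0.
    by apply: nbhs_right_lt; rewrite divr_gt0.
  move=> [x' eta] [/= xx' etar] z x'z.
  have xz : ball x r z.
    rewrite (splitr r); apply: (ball_triangle xx').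
    by apply: le_ball x'z; exact: ltW.
  have xx'r : ball x r x' by apply: le_ball xx'; move: r0 => /=; lra.
  rewrite (le_trans (ler_distD (f x) _ _))// [leRHS]splitr lerD//.
    by rewrite distrC; exact: hr.
  exact: hr.
rewrite /ball/= sub0r normrN ger0_norm ?divr_ge0 ?ltW//.
have e2 : eta / 2 < eta by move: eta0 => /=; lra.
have e20 : 0 < eta / 2 by move: eta0 => /=; lra.
move=> /(_ e2 e20) h.
exists (eta / 2); first by rewrite divr_gt0.
move=> x xrho z zx; apply: h.
  by move=> i; rewrite in_itv/= -ler_norml.
split; first by rewrite divr_gt0.
by move=> i j; rewrite (ord1 i) /ball/= distrC.
Qed.

(** For [z] near [x] the term [e] suffices. Otherwise some coordinate differs by at least [eta], and
    the trivial bound [2 * M] is at most [2 * M / eta ^+ 2] times the squared distance. *)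
Lemma continuous_quadratic_modulus f (M rho e : R) :
  continuous f -> (forall x, `|f x| <= M) -> 0 < e ->
  exists2 K : R, 0 <= K & forall x, (forall i, `|x 0 i| <= rho) ->
    forall z, `|f z - f x| <= e + K * \sum_i (z 0 i - x 0 i) ^+ 2.
Proof.
move=> cf fM e0.
have [eta eta0 heta] := near_unif_continuous rho cf e0.
have M0 : 0 <= M := le_trans (normr_ge0 (f 0)) (fM 0).
exists (2 * M / eta ^+ 2).
  by rewrite divr_ge0 ?sqr_ge0 ?mulr_ge0.
move=> x xrho z.
have [near|] := pselect (forall i, `|z 0 i - x 0 i| < eta).
  rewrite (le_trans (heta _ xrho _ near))// lerDl mulr_ge0//.
    by rewrite divr_ge0 ?sqr_ge0 ?mulr_ge0.
  by apply: sumr_ge0 => i _; exact: sqr_ge0.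
move=> /existsNP[i /negP]; rewrite -leNgt => far.
apply: (@le_trans _ _ (2 * M)).
  by rewrite (le_trans (ler_normB _ _))// mulr2n mulrDl mul1r lerD.
rewrite -[leLHS]add0r; apply: lerD; first exact: ltW.
rewrite -mulrA [_^-1 * _]mulrC; apply: ler_peMr; first exact: mulr_ge0.
rewrite ler_pdivlMr ?exprn_gt0// mul1r (bigD1 i)//=.
rewrite -[leLHS]addr0 lerD//; last by apply: sumr_ge0 => j _; exact: sqr_ge0.
by rewrite -[leRHS]real_normK ?num_real// lerXn2r ?nnegrE ?(ltW eta0)//.
Qed.

(** The walk from 0 has mean [h * N%:R * sin (w * x 0 i)] along [i]. With [h = (w * N)^-1] this is
    close to [x 0 i] on a cube when [w] is small, and a large [N] then kills the variance. Outside
    the cube the quadratic weight absorbs the trivial bound [2 * M]. *)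
Lemma trig_poly_approx f (M e : R) :
  continuous f -> (forall x, `|f x| <= M) -> 0 < e ->
  exists2 g, trig_poly g &
    forall x, `|g x - f x| <= e * (1 + \sum_i x 0 i ^+ 2).
Proof.
move=> cf fM e0.
have M0 : 0 <= M := le_trans (normr_ge0 (f 0)) (fM 0).
(* Since [rho ^+ 2 >= rho >= 2 * M / e], the allowed error exceeds [2 * M] as soon as one coordinate
   exceeds [rho]. *)
pose rho := 1 + 2 * M / e.
have rho1 : 1 <= rho by rewrite /rho lerDl divr_ge0 ?mulr_ge0 ?(ltW e0).
have rho0 : 0 < rho by exact: lt_le_trans rho1.
have e20 : 0 < e / 2 by rewrite divr_gt0.
have [K K0 hK] := continuous_quadratic_modulus rho cf fM e20.
(* On the cube, squared bias and variance will each be at most [e / C] per coordinate; [K] times the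
   sum of these [2 k] terms is then at most [e / 2]. The summand 1 keeps [C] positive. *)
pose C := K * k%:R * 4 + 1.
have C0 : 0 < C.
  by rewrite /C; apply: ltr_wpDl => //; rewrite !mulr_ge0 ?ler0n.
(* The bias is at most [eta * rho], the minimum of 1 and [e / C]; being at most 1, it dominates its
   own square. *)
pose eta := Num.min 1 (e / C) / rho.
have eta0 : 0 < eta by rewrite divr_gt0// lt_min ltr01 divr_gt0.
have [del del0 hdel] := sin_near0 eta0.
pose w := del / (2 * rho).
have w0 : 0 < w by rewrite divr_gt0// mulr_gt0.
have wrho : w * rho < del.
  have -> : w * rho = del / 2 by rewrite /w; field; rewrite gt_eqF.
  by rewrite ltr_pdivrMr// ltr_pMr// ltr1n.
clearbody w.
(* Chosen so that the variance bound [h ^+ 2 * N%:R = (w ^+ 2 * N%:R)^-1] is at most [e / C]. *)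
pose N := (Num.truncn (C / (w ^+ 2 * e))).+1.
have N0 : 0 < N%:R :> R by rewrite ltr0n.
have hN : C / (w ^+ 2 * e) <= N%:R by rewrite ltW// truncnS_gt.
clearbody N; pose h := (w * N%:R)^-1.
pose js := flatten (nseq N (enum 'I_k)).
have cjs i : count_mem i js = N.
  rewrite count_flatten map_nseq sumn_nseq.
  by rewrite count_uniq_mem ?enum_uniq// mem_enum mul1n.
exists (fun x => walk (fun j => sin (w * x 0 j)) h js f 0).
  exact: trig_poly_walk.
move=> x.
have s1 j : `|sin (w * x 0 j)| <= 1 by exact: sin_max.
have [xr|] := pselect (forall i, `|x 0 i| <= rho); last first.
  move=> /existsNP[i /negP]; rewrite -ltNge => xi.
  (* Outside the cube [walk_dist] is applied with [K = 0], so the position of the walk is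
     irrelevant. *)
  have fL z : `|f z - f x| <= 2 * M + 0 * \sum_i (z 0 i - x 0 i) ^+ 2.
    by rewrite mul0r addr0 (le_trans (ler_normB _ _))// mulr2n mulrDl mul1r lerD.
  apply: (le_trans (walk_dist h s1 cjs (lexx 0) fL)).
  rewrite mul0r addr0 -ler_pdivrMl//.
  rewrite (@le_trans _ _ (rho ^+ 2))//.
    apply: (@le_trans _ _ rho); first by rewrite /rho mulrC lerDr.
    by rewrite expr2 ler_peMl// ltW.
  rewrite -[leLHS]add0r lerD// (bigD1 i)//= -[leLHS]addr0 lerD//.
    by rewrite -[leRHS]real_normK ?num_real// lerXn2r ?nnegrE// (ltW rho0, ltW xi).
  by apply: sumr_ge0 => j _; exact: sqr_ge0.
apply: (le_trans (walk_dist h s1 cjs K0 (hK x xr))).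
have hNe : h * N%:R = w^-1 by rewrite /h invfM mulfVK// gt_eqF.
have h2 : h ^+ 2 * N%:R <= e / C.
  have -> : h ^+ 2 * N%:R = (w ^+ 2 * N%:R)^-1.
    by rewrite expr2 -mulrA hNe /h -invfM; congr (_^-1); ring.
  rewrite ler_pdivlMr// mulrC ler_pdivrMr ?mulr_gt0 ?exprn_gt0//.
  move: hN; rewrite ler_pdivrMr ?mulr_gt0 ?exprn_gt0// => /le_trans; apply.
  by rewrite mulrCA mulrA mulrC.
have d1 i : (h * N%:R * sin (w * x 0 i) - x 0 i) ^+ 2 <= e / C.
  have wx : `|w * x 0 i| < del.
    rewrite normrM (gtr0_norm w0) (le_lt_trans _ wrho)//.
    by rewrite ler_wpM2l// ltW.
  have := hdel _ wx; rewrite hNe => hs.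
  have : `|w^-1 * sin (w * x 0 i) - x 0 i| <= Num.min 1 (e / C).
    have -> : w^-1 * sin (w * x 0 i) - x 0 i = (sin (w * x 0 i) - w * x 0 i) / w.
      by field; rewrite gt_eqF.
    rewrite normrM normfV (gtr0_norm w0) ler_pdivrMr// (le_trans hs)//.
    rewrite normrM (gtr0_norm w0) mulrCA [leRHS]mulrC.
    apply: (ler_wpM2l (ltW w0)).
    by rewrite (le_trans (ler_wpM2l (ltW eta0) (xr i)))// /eta divfK ?gt_eqF.
  set D := _ - _; rewrite le_min => /andP[D1 D2].
  rewrite -[leLHS]real_normK ?num_real// (le_trans _ D2)//.
  by rewrite expr2 ler_piMl.
apply: (@le_trans _ _ (e / 2 + e / 2)); last first.
  rewrite -splitr; apply: ler_peMr; first exact: ltW.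
  by rewrite lerDl; apply: sumr_ge0 => i _; exact: sqr_ge0.
rewrite lerD2l (@le_trans _ _ (K * \sum_(i < k) (e / C + e / C)))//.
  by rewrite ler_wpM2l//; apply: ler_sum => i _; rewrite lerD.
rewrite sumr_const card_ord -[_ *+ k]mulr_natr.
have -> : K * ((e / C + e / C) * k%:R) = e / 2 * (K * k%:R * 4 / C).
  by field; rewrite gt_eqF.
by apply: ler_piMr; [exact: ltW|rewrite ler_pdivrMr// mul1r /C lerDl].
Qed.

End TrigApprox.
(** * Gaussian variables *)

Section NormalIntegral.
Context {R : realType}.
Local Notation mu := (@lebesgue_measure R).

(** The Radon-Nikodym derivative of [normal_prob m s] and [normal_pdf m s] have the same integral
    over every measurable set, hence agree almost everywhere. *)
Lemma ge0_integral_normal_prob (m s : R) (f : R -> \bar R) :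
  measurable_fun setT f -> (forall x, 0 <= f x)%E ->
  (\int[normal_prob m s]_x f x = \int[mu]_x (f x * (normal_pdf m s x)%:E))%E.
Proof.
move=> mf f0.
have dom := normal_prob_dominates m s.
rewrite -(Radon_Nikodym_SigmaFinite.change_of_variables dom)//.
have mpdf : measurable_fun [set: R] (EFin \o normal_pdf m s).
  by apply/measurable_EFinP; exact: measurable_normal_pdf.
have irn := Radon_Nikodym_SigmaFinite.f_integrable dom.
apply: ae_eq_integral => //.
- by apply: emeasurable_funM => //; exact: measurable_int irn.
- exact: emeasurable_funM.
- apply: ae_eqe_mul2l => /=.
  apply: integral_ae_eq => //= E _ mE.
  by rewrite -Radon_Nikodym_SigmaFinite.f_integral.
Qed.

Lemma normal_pdf_neq0E (m s x : R) : s != 0 ->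
  normal_pdf m s x = normal_peak s * normal_fun m s x.
Proof. by move=> s0; rewrite normal_pdfE. Qed.

Local Notation N01 := (@normal_prob R 0 1).

Lemma continuous_affine (m s : R) : continuous (fun y : R => m + s * y).
Proof.
by move=> y; apply: cvgD;
  [exact: cvg_cst|apply: cvgM; [exact: cvg_cst|exact: cvg_id]].
Qed.

Lemma integral_normal_prob_scale (m s : R) (g : R -> R) : 0 < s ->
  continuous g -> (forall x, 0 <= g x) ->
  (\int[normal_prob m s]_x (g x)%:E = \int[N01]_y (g (m + s * y))%:E)%E.
Proof.
move=> s0 cg g0.
have s_neq0 : s != 0 by rewrite gt_eqF.
have cF : continuous (fun y : R => m + s * y) by exact: continuous_affine.
have cgF : continuous (fun y => g (m + s * y)).
  by move=> y; apply: continuous_comp; [exact: cF|exact: cg].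
have mg (h : R -> R) : continuous h -> measurable_fun [set: R] (EFin \o h).
  by move=> ch; apply/measurable_EFinP; exact: continuous_measurable_fun.
rewrite ge0_integral_normal_prob; [|exact: (mg _ cg)|by move=> x; rewrite lee_fin].
rewrite ge0_integral_normal_prob; [|exact: (mg _ cgF)|by move=> x; rewrite lee_fin].
have F'E : (fun y : R => m + s * y)^`()%classic = cst s.
  apply/funext => x; rewrite derive1E deriveD// derive_cst add0r.
  by rewrite deriveM// derive_cst scaler0 addr0 derive_id -[LHS]/(s * 1) mulr1.
have FE : (fun y : R => m + s * y) = (fun y => s * (m / s + y)).
  by apply/funext => y; rewrite mulrDr mulrCA divff// mulr1.
under eq_integral do rewrite -EFinM.
rewrite (@increasing_ge0_integration_by_substitutionT _ (fun y => m + s * y)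
   (fun x => g x * normal_pdf m s x)).
- apply: eq_integral => y _; rewrite F'E /= -mulrA EFinM; congr (_ * _%:E)%E.
  rewrite -[LHS]/(normal_pdf m s (m + s * y) * s).
  rewrite !normal_pdf_neq0E ?oner_neq0// /normal_peak /normal_fun.
  have -> : - (m + s * y - m) ^+ 2 / (s ^+ 2 *+ 2) = - (y - 0) ^+ 2 / (1 ^+ 2 *+ 2).
    by field.
  rewrite mulrAC; congr (_ * _).
  rewrite expr1n mul1r -mulrnAr sqrtrM ?sqr_ge0// sqrtr_sqr gtr0_norm//.
  by rewrite invfM mulrAC mulVf// mul1r.
- by move=> x y xy; rewrite ltrD2l ltr_pM2l.
- by rewrite F'E => ?; exact: cvg_cst.
- by rewrite F'E; exact: is_cvg_cst.
- by rewrite F'E; exact: is_cvg_cst.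
- by move=> x; apply: derivableD => //; apply: derivableM.
- by rewrite FE; apply: gt0_cvgMrNy => //; exact: cvg_addrl_Ny.
- by rewrite FE; apply: gt0_cvgMry => //; exact: cvg_addrl.
- by move=> x; apply: cvgM; [exact: cg|exact: continuous_normal_pdf].
- by move=> x; rewrite mulr_ge0// normal_pdf_ge0.
Qed.

Lemma integral_normal01_opp (g : R -> R) :
  continuous g -> (forall x, 0 <= g x) ->
  (\int[N01]_y (g (- y))%:E = \int[N01]_y (g y)%:E)%E.
Proof.
move=> cg g0.
have cgN : continuous (fun y => g (- y)).
  by move=> y; apply: continuous_comp; [exact: cvgN|exact: cg].
have mg (h : R -> R) : continuous h -> measurable_fun [set: R] (EFin \o h).
  by move=> ch; apply/measurable_EFinP; exact: continuous_measurable_fun.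
rewrite ge0_integral_normal_prob; [|exact: (mg _ cgN)|by move=> x; rewrite lee_fin].
rewrite ge0_integral_normal_prob; [|exact: (mg _ cg)|by move=> x; rewrite lee_fin].
have pN y : normal_pdf 0 1 (- y) = normal_pdf 0 1 y :> R.
  by rewrite !normal_pdf_neq0E ?oner_neq0// /normal_fun !subr0 sqrrN.
pose h (x : measurableTypeR R) := ((g x)%:E * (normal_pdf 0 1 x)%:E)%E.
have mh : measurable_fun setT h.
  apply: emeasurable_funM; first exact: mg.
  by apply/measurable_EFinP; exact: measurable_normal_pdf.
transitivity (\int[mu]_y (h \o (-%R : _ -> measurableTypeR R)) y)%E.
  by apply: eq_integral => y _; rewrite /h/= pN.
rewrite -[RHS]/(\int[mu]_x h x)%E.
rewrite [RHS](eq_measure_integral (pushforward mu (-%R : _ -> measurableTypeR R))); last first.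
  by move=> A mA _; exact/esym/lebesgue_measureN.
rewrite ge0_integral_pushforward// => y _.
by rewrite mule_ge0// lee_fin// normal_pdf_ge0.
Qed.

End NormalIntegral.

(** * Expected cosines of a Gaussian variable *)

Section GaussianRv.
Context {R : realType}.
Local Notation N01 := (@normal_prob R 0 1).

(** This removes the case distinction of [gaussian_law]: the affine image [m + s * y] of N(0, 1) is
    the Dirac mass at [m] when [s = 0]. *)
Lemma gaussian_rv_integral d (T : measurableType d) (P : probability T R)
    (Y : T -> R) : measurable_fun setT Y -> gaussian_rv P Y ->
  exists m s : R, 0 <= s /\ forall g : R -> R, continuous g ->
    (forall x, 0 <= g x) ->
    (\int[P]_w (g (Y w))%:E = \int[N01]_y (g (m + s * y))%:E)%E.
Proof.
move=> mY [m [s [s0 lawY]]]; exists m, s; split => // g cg g0.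
have mg : measurable_fun [set: R] (EFin \o g).
  by apply/measurable_EFinP; exact: continuous_measurable_fun.
transitivity (\int[pushforward P (Y : T -> measurableTypeR R)]_x (g x)%:E)%E.
  by rewrite ge0_integral_pushforward// => y _; rewrite lee_fin.
have [s_eq0|s_neq0] := eqVneq s 0.
  rewrite (eq_measure_integral (\d_ (m : measurableTypeR R))); last first.
    by move=> A mA _; have := lawY A mA; rewrite /gaussian_law s_eq0 eqxx.
  rewrite integral_dirac// diracT mul1e s_eq0.
  under eq_integral do rewrite mul0r addr0.
  by rewrite integral_cst//= probability_setT mule1.
rewrite (eq_measure_integral (normal_prob m s)); last first.
  by move=> A mA _; have := lawY A mA; rewrite /gaussian_law (negbTE s_neq0).
have {s_neq0}s_gt0 : 0 < s by rewrite lt_def s_neq0.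
exact: (integral_normal_prob_scale _ s_gt0 cg g0).
Qed.

(** Kept in [\bar R]: only positivity is proved directly, and finiteness is deduced from a
    nondegenerate Gaussian variable of finite variance. *)
Definition normal01_moment2 : \bar R := (\int[N01]_y (y ^+ 2)%:E)%E.

(** On the interval from 1 to 2, [x ^+ 2] is at least 1 and the density is at least its value at
    2. *)
Lemma normal01_moment2_gt0 : (0 < normal01_moment2)%E.
Proof.
rewrite /normal01_moment2 ge0_integral_normal_prob//; last first.
- by move=> y; rewrite lee_fin sqr_ge0.
- by apply/measurable_EFinP; exact: measurable_funX.
have mf : measurable_fun [set: R] (fun x : R => ((x ^+ 2)%:E * (normal_pdf 0 1 x)%:E)%E).
  apply: emeasurable_funM; apply/measurable_EFinP; first exact: measurable_funX.
  exact: measurable_normal_pdf.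
have f0 x : (0 <= (x ^+ 2)%:E * (normal_pdf 0 1 x)%:E :> \bar R)%E.
  by rewrite mule_ge0// lee_fin ?sqr_ge0 ?normal_pdf_ge0.
pose c : R := normal_pdf 0 1 2.
have c0 : 0 < c.
  by rewrite /c normal_pdf_neq0E ?oner_neq0// mulr_gt0 ?expR_gt0// normal_peak_gt0 ?oner_neq0.
apply: (@lt_le_trans _ _ (\int[lebesgue_measure]_(x in `[1%R, 2%R]) c%:E)%E).
  rewrite integral_cst//= lebesgue_measure_itv/= lte_fin ltr1n/= -EFinB.
  by rewrite -EFinM lte_fin mulr_gt0// subr_gt0 ltr1n.
apply: (@le_trans _ _ (\int[lebesgue_measure]_(x in `[1%R, 2%R])
    ((x ^+ 2)%:E * (normal_pdf 0 1 x)%:E))%E); last first.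
  exact: ge0_subset_integral.
apply: ge0_le_integral => //=.
- by move=> x _; rewrite lee_fin ltW.
- exact: measurable_funTS.
- move=> x; rewrite in_itv/= => /andP[x1 x2].
  rewrite -EFinM lee_fin; apply: (@le_trans _ _ (normal_pdf 0 1 x)).
    rewrite /c !normal_pdf_neq0E ?oner_neq0// ler_wpM2l ?normal_peak_ge0//.
    rewrite ler_expR !subr0 !mulNr lerN2.
    apply: ler_wpM2r; first by rewrite invr_ge0 mulrn_wge0// sqr_ge0.
    by apply: lerXn2r; rewrite ?nnegrE//; exact: le_trans x1.
  by rewrite ler_peMl ?normal_pdf_ge0// expr_ge1//; exact: le_trans x1.
Qed.

(* E cos(b + Y) for a centered Gaussian variable Y of variance v; dividing by
   the second moment of N(0, 1) avoids computing it. *)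
Definition gaussian_cos (b v : R) : R :=
  \int[N01]_y cos (b + Num.sqrt (v / fine normal01_moment2) * y).

Lemma measurable_cos : measurable_fun [set: R] (@cos R).
Proof. by apply: continuous_measurable_fun; exact: continuous_cos. Qed.

Lemma integrable_cos d (T : measurableType d) (P : probability T R) (Y : T -> R) :
  measurable_fun setT Y -> P.-integrable setT (fun w => (cos (Y w))%:E).
Proof.
move=> mY; apply: measurable_bounded_integrable => //.
- exact: fin_num_fun_lty.
- exact: (measurableT_comp measurable_cos).
- exists 1; split => // x x1 w _ /=; rewrite (le_trans _ (ltW x1))//.
  exact: cos_max.
Qed.

(** The law of [Y] is transferred for nonnegative functions only, so cosines are handled through
    [1 + cos]. *)
Lemma integral_1Dcos d (T : measurableType d) (P : probability T R) (Y : T -> R) :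
  measurable_fun setT Y ->
  (\int[P]_w (1 + cos (Y w))%:E = 1 + \int[P]_w (cos (Y w))%:E)%E.
Proof.
move=> mY; under eq_integral do rewrite EFinD.
rewrite integralD//=; last exact: integrable_cos.
  by rewrite integral_cst//= probability_setT mule1.
by apply/finite_measure_integrable_cst.
Qed.

(* The quadratic moments at 0 and 2m show that the mean vanishes, since the
   reflection of N(0, 1) exchanges them. *)
Lemma integral_gaussian_cos d (T : measurableType d) (P : probability T R)
    (Y : T -> R) (b v : R) : measurable_fun setT Y -> gaussian_rv P Y ->
  (forall a, \int[P]_w ((Y w - a) ^+ 2)%:E = (v + a ^+ 2)%:E)%E ->
  (\int[P]_w (cos (b + Y w))%:E = (gaussian_cos b v)%:E)%E.
Proof.
move=> mY gY quadY.
have [m [s [s0 intY]]] := gaussian_rv_integral mY gY.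
have cq (a : R) : continuous (fun x : R => (x - a) ^+ 2).
  move=> x; apply: (@continuous_comp _ _ _ (fun y => y - a) (fun z => z ^+ 2)).
    by apply: cvgB; [exact: cvg_id|exact: cvg_cst].
  exact: exprn_continuous.
have q0 (a x : R) : 0 <= (x - a) ^+ 2 by exact: sqr_ge0.
have quadN (a : R) : (\int[N01]_y ((m + s * y - a) ^+ 2)%:E = (v + a ^+ 2)%:E)%E.
  by rewrite -quadY (intY (fun x => (x - a) ^+ 2)).
have m0 : m = 0.
  have := integral_normal01_opp (g := fun y => (m + s * y - 0) ^+ 2).
  have -> : (\int[N01]_y ((m + s * y - 0) ^+ 2)%:E = (v + 0 ^+ 2)%:E)%E by [].
  have -> : (\int[N01]_y ((m + s * - y - 0) ^+ 2)%:E = (v + (2 * m) ^+ 2)%:E)%E.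
    by rewrite -quadN; apply: eq_integral => y _; congr (_%:E); ring.
  move=> /(_ _ (fun=> sqr_ge0 _)) h.
  have {}h : v + (2 * m) ^+ 2 = v + 0 ^+ 2.
    apply: EFin_inj; apply: h => y.
    apply: (@continuous_comp _ _ _ (fun y => m + s * y) (fun z => (z - 0) ^+ 2)).
      exact: continuous_affine.
    exact: cq.
  by move: h => /addrI/eqP; rewrite expr0n/= sqrf_eq0 mulf_eq0 pnatr_eq0/= => /eqP.
subst m.
have vE : (\int[N01]_y ((s * y) ^+ 2)%:E = v%:E)%E.
  have := quadN 0; rewrite expr0n/= addr0 => <-.
  by apply: eq_integral => y _; rewrite subr0 add0r.
have {}vE : ((s ^+ 2)%:E * normal01_moment2 = v%:E)%E.
  rewrite -vE /normal01_moment2 -ge0_integralZl//; first last.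
  - by rewrite lee_fin sqr_ge0.
  - by move=> y _; rewrite lee_fin sqr_ge0.
  - by apply/measurable_EFinP; exact: measurable_funX.
  by apply: eq_integral => y _; rewrite exprMn EFinM.
(* If [s = 0] then [v = 0] and the formula holds whatever the denominator. If not, [s ^+ 2] times
   the moment equals the real [v], which forces the moment to be finite. *)
have sE : s = Num.sqrt (v / fine normal01_moment2).
  have k0 := normal01_moment2_gt0.
  have [s_eq0|s_neq0] := eqVneq s 0.
    have v0 : v = 0 by apply: EFin_inj; rewrite -vE s_eq0 expr0n mul0e.
    by rewrite s_eq0 v0 mul0r sqrtr0.
  have s2 : 0 < s ^+ 2 by rewrite exprn_even_gt0.
  have kfin : normal01_moment2 \is a fin_num.
    rewrite ge0_fin_numE ?ltW//.
    rewrite ltey; apply/eqP => kE; move: vE.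
    by rewrite kE gt0_muley ?lte_fin.
  have -> : v = s ^+ 2 * fine normal01_moment2.
    by apply: EFin_inj; rewrite -vE (EFinM (s ^+ 2)) fineK.
  rewrite mulfK ?sqrtr_sqr ?ger0_norm// gt_eqF//.
  by rewrite -lte_fin fineK.
have m1 : measurable_fun setT (fun w => b + Y w).
  by apply: measurable_funD.
have m2 : measurable_fun [set: R] (fun y => b + s * y).
  by apply: continuous_measurable_fun; exact: continuous_affine.
have cc : continuous (fun x : R => 1 + cos (b + x)).
  move=> x; apply: cvgD; first exact: cvg_cst.
  apply: (@continuous_comp _ _ _ (fun y => b + y) cos); last exact: continuous_cos.
  by apply: cvgD; [exact: cvg_cst|exact: cvg_id].
have h : (\int[P]_w (1 + cos (b + Y w))%:E =
    \int[N01]_y (1 + cos (b + s * y))%:E)%E.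
  rewrite (intY _ cc) => [|x]; last by rewrite -lerBlDl sub0r cos_geN1.
  by apply: eq_integral => y _; rewrite add0r.
move: h; rewrite integral_1Dcos// integral_1Dcos//.
move=> h; rewrite /gaussian_cos /Rintegral -sE fineK; last first.
  by apply: integrable_fin_num => //; exact: integrable_cos.
have e : forall u w : \bar R, u \is a fin_num -> w \is a fin_num ->
    (1 + u = 1 + w -> u = w)%E.
  by move=> [u||] [w||]// _ _ [] /addrI ->.
apply: e h; first by apply: integrable_fin_num => //; exact: integrable_cos.
by apply: integrable_fin_num => //; exact: integrable_cos.
Qed.

(** Dominated convergence with bound 1, composed with [Num.sqrt], which is continuous also at 0;
    degenerate limits are thus included. *)
Lemma continuous_gaussian_cos (b : R) : continuous (gaussian_cos b).
Proof.
move=> v.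
pose Psi (r : R) : R := \int[N01]_y cos (b + r * y).
pose sg (w : R) : R := Num.sqrt (w / fine normal01_moment2).
have csg : sg w @[w --> v] --> sg v.
  apply: (cvg_comp (fun w => w / fine normal01_moment2) (@Num.sqrt R)); last exact: sqrt_continuous.
  by apply: cvgM; [exact: cvg_id|exact: cvg_cst].
suff cPsi : {for sg v, continuous Psi} by exact: (continuous_cvg _ cPsi csg).
set r0 := sg v.
have := @continuity_under_integral R _ _ N01 (fun r y => cos (b + r * y)) setT
  measurableT (r0 - 1) (r0 + 1).
have ma r : measurable_fun [set: R] (fun y => b + r * y).
  by apply: continuous_measurable_fun; exact: continuous_affine.
move=> /(_ _ _ (cst 1)); apply.
- by move=> r _; exact: (integrable_cos N01 (ma r)).
- apply: aeW => y _ r _.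
  apply: (cvg_comp (fun r => b + r * y) (@cos R)); last exact: continuous_cos.
  apply: cvgD; first exact: cvg_cst.
  by apply: cvgM; [exact: cvg_id|exact: cvg_cst].
- by apply/finite_measure_integrable_cst.
- by move=> r _; apply: aeW => y _; exact: cos_max.
- by rewrite inE/= in_itv/= ltrBlDr !ltrDl ltr01.
Qed.

End GaussianRv.
(** * Gaussian vectors *)

Lemma cvg_sumr {R : realType} {J I : Type} (F : set_system I) {FF : Filter F}
    (r : seq J) (f : J -> I -> R) (l : J -> R) :
  (forall j, f j x @[x --> F] --> l j) ->
  \sum_(j <- r) f j x @[x --> F] --> \sum_(j <- r) l j.
Proof.
by move=> fl; apply: cvg_big => [|j _]; [exact: add_continuous|exact: fl].
Qed.

Lemma cvg_prodr {R : realType} {J I : Type} (F : set_system I) {FF : Filter F}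
    (r : seq J) (f : J -> I -> R) (l : J -> R) :
  (forall j, f j x @[x --> F] --> l j) ->
  \prod_(j <- r) f j x @[x --> F] --> \prod_(j <- r) l j.
Proof.
by move=> fl; apply: cvg_big => [|j _]; [exact: mul_continuous|exact: fl].
Qed.

Section GaussianVector.
Context {R : realType} {k : nat}.
Implicit Types C : 'I_k -> 'I_k -> R.

(** Gaussianity is required of all linear combinations, which admits singular covariances. The
    covariance [C] is a parameter, so that vectors on different spaces can be compared through
    it. *)
Definition centered_gaussian_vector d (T : measurableType d)
    (P : probability T R) (Y : 'I_k -> T -> R) C : Prop :=
  [/\ forall j, measurable_fun setT (Y j),
      forall c : 'I_k -> R, gaussian_rv P (fun w => \sum_j c j * Y j w),
      forall j, (\int[P]_w (Y j w)%:E = 0)%E &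
      forall i j, (\int[P]_w (Y i w * Y j w)%:E = (C i j)%:E)%E].

Definition quad_form (c : 'I_k -> R) C : R := \sum_i \sum_j c i * c j * C i j.

Section Moments.
Context d (T : measurableType d) (P : probability T R) (Y : 'I_k -> T -> R) C.
Hypothesis hY : centered_gaussian_vector P Y C.

Let mY j : measurable_fun setT (Y j). Proof. by case: hY. Qed.

(** The integral of a square always makes sense in [\bar R], and here it equals the real number
    [C j j]. *)
Lemma integrable_sqr_gaussian_vector j :
  P.-integrable setT (fun w => (Y j w ^+ 2)%:E).
Proof.
apply/integrableP; split; first by apply/measurable_EFinP; exact: measurable_funX.
under eq_integral do rewrite gee0_abs ?lee_fin ?sqr_ge0// expr2.
by case: hY => _ _ _ ->; rewrite ltry.
Qed.

Lemma integrable_gaussian_vector j : P.-integrable setT (fun w => (Y j w)%:E).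
Proof.
apply: (@le_integrable _ _ _ _ _ measurableT _ (fun w => 1 + (Y j w ^+ 2)%:E)%E).
- exact/measurable_EFinP.
- move=> w _; rewrite -EFinD !abse_EFin lee_fin.
  rewrite [leRHS]ger0_norm ?addr_ge0 ?sqr_ge0// -real_normK ?num_real//.
  have := sqr_ge0 (`|Y j w| - 1); have := normr_ge0 (Y j w); nra.
- apply: integrableD => //; last exact: integrable_sqr_gaussian_vector.
  exact: finite_measure_integrable_cst.
Qed.

Lemma integrable_mul_gaussian_vector i j :
  P.-integrable setT (fun w => (Y i w * Y j w)%:E).
Proof.
apply: (@le_integrable _ _ _ _ _ measurableT _
  (fun w => (Y i w ^+ 2)%:E + (Y j w ^+ 2)%:E)%E).
- by apply/measurable_EFinP; exact: measurable_funM.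
- move=> w _; rewrite -EFinD !abse_EFin lee_fin.
  rewrite [leRHS]ger0_norm ?addr_ge0 ?sqr_ge0// normrM.
  rewrite -(real_normK (num_real (Y i w))) -(real_normK (num_real (Y j w))).
  have := sqr_ge0 (`|Y i w| - `|Y j w|).
  have := normr_ge0 (Y i w); have := normr_ge0 (Y j w); nra.
- by apply: integrableD => //; exact: integrable_sqr_gaussian_vector.
Qed.

(** [quad_form c C] is the variance of the combination, and the cross term in [a] vanishes because
    the means do. This is the form of the moments that [integral_gaussian_cos] takes. *)
Lemma quad_moment_gaussian_vector (c : 'I_k -> R) (a : R) :
  (\int[P]_w ((\sum_j c j * Y j w - a) ^+ 2)%:E = (quad_form c C + a ^+ 2)%:E)%E.
Proof.
case: hY => _ _ EY EYY.
have i2 i j : P.-integrable setT (fun w => (c i * c j)%:E * (Y i w * Y j w)%:E)%E.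
  by apply: integrableZl => //; exact: integrable_mul_gaussian_vector.
have i1 j : P.-integrable setT (fun w => (- (2 * a) * c j)%:E * (Y j w)%:E)%E.
  by apply: integrableZl => //; exact: integrable_gaussian_vector.
transitivity (\int[P]_w (\sum_i (\sum_j ((c i * c j)%:E * (Y i w * Y j w)%:E)) +
   (\sum_j ((- (2 * a) * c j)%:E * (Y j w)%:E) + (a ^+ 2)%:E)))%E.
  apply: eq_integral => w _.
  transitivity ((\sum_i \sum_j c i * c j * (Y i w * Y j w) +
      (\sum_j - (2 * a) * c j * Y j w + a ^+ 2))%:E); last first.
    rewrite !EFinD -!sumEFin; congr (_ + _)%E; apply: eq_bigr => i _.
    by rewrite -sumEFin.
  congr _%:E.
  have -> : \sum_i \sum_j c i * c j * (Y i w * Y j w) = (\sum_j c j * Y j w) ^+ 2.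
    rewrite expr2 mulr_suml; apply: eq_bigr => i _; rewrite mulr_sumr.
    by apply: eq_bigr => j _; ring.
  have -> : \sum_j - (2 * a) * c j * Y j w = - (2 * a) * \sum_j c j * Y j w.
    by rewrite mulr_sumr; apply: eq_bigr => j _; rewrite mulrA.
  by ring.
have i3 i : P.-integrable setT
    (fun w => \sum_j ((c i * c j)%:E * (Y i w * Y j w)%:E))%E.
  exact: integrable_sum.
rewrite integralD//=; first last.
- apply: integrableD => //; first exact: integrable_sum.
  exact: finite_measure_integrable_cst.
- exact: integrable_sum.
rewrite integralD//=; first last.
- exact: finite_measure_integrable_cst.
- exact: integrable_sum.
rewrite integral_cst//= probability_setT mule1.
rewrite integral_sum//= integral_sum//=.
rewrite [X in (_ + (X + _))%E]big1 ?add0e => [|j _]; last first.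
  by rewrite integralZl//= ?EY ?mule0//; exact: integrable_gaussian_vector.
rewrite EFinD; congr (_ + _)%E; rewrite /quad_form -sumEFin.
apply: eq_bigr => i _; rewrite integral_sum//= -sumEFin; apply: eq_bigr => j _.
rewrite integralZl//= ?EYY -?EFinM//; exact: integrable_mul_gaussian_vector.
Qed.

Lemma measurable_sum_gaussian_vector (c : 'I_k -> R) :
  measurable_fun setT (fun w => \sum_j c j * Y j w).
Proof. by apply: measurable_sum => j; exact: measurable_funM. Qed.

Lemma integral_cos_gaussian_vector (b : R) (c : 'I_k -> R) :
  (\int[P]_w (cos (b + \sum_j c j * Y j w))%:E =
   (gaussian_cos b (quad_form c C))%:E)%E.
Proof.
apply: integral_gaussian_cos.
- exact: measurable_sum_gaussian_vector.
- by case: hY.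
- exact: quad_moment_gaussian_vector.
Qed.

Lemma trig_poly_gaussian_vector (g : 'rV[R]_k -> R) : trig_poly g ->
  P.-integrable setT (fun w => (g (\row_j Y j w))%:E).
Proof.
elim=> [a b c|g1 g2 _ ih1 _ ih2].
  under eq_fun do rewrite EFinM; apply: integrableZl => //.
  apply: integrable_cos; apply: measurable_funD => //.
  rewrite (_ : (fun w => _) = fun w => \sum_j c j * Y j w).
    exact: measurable_sum_gaussian_vector.
  by apply/funext => w; apply: eq_bigr => j _; rewrite mxE.
by under eq_fun do rewrite EFinD; exact: integrableD.
Qed.

(** Pointwise limit of trigonometric polynomials in [Y]: at a fixed [w] the error is [n.+1%:R^-1]
    times a constant. No sigma-algebra on row vectors enters. *)
Lemma measurable_continuous_gaussian_vector (f : 'rV[R]_k -> R) (M : R) :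
  continuous f -> (forall x, `|f x| <= M) ->
  measurable_fun setT (fun w => f (\row_j Y j w)).
Proof.
move=> cf fM.
have e0 n : 0 < n.+1%:R^-1 :> R by rewrite invr_gt0 ltr0n.
have /choice[g hg] : forall n, exists g, trig_poly g /\
    forall x, `|g x - f x| <= n.+1%:R^-1 * (1 + \sum_i x 0 i ^+ 2).
  by move=> n; have [g] := trig_poly_approx cf fM (e0 n); exists g.
apply: (@measurable_fun_cvg _ _ _ _ (fun n w => g n (\row_j Y j w))).
  move=> n; apply/measurable_EFinP.
  by apply: (measurable_int P); apply: trig_poly_gaussian_vector; case: (hg n).
move=> w _; set x := \row_j Y j w.
apply/cvgrPdist_le => e e_gt0.
have S0 : 0 < 1 + \sum_i x 0 i ^+ 2.
  by apply: ltr_wpDr => //; apply: sumr_ge0 => i _; exact: sqr_ge0.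
near=> n; rewrite distrC (le_trans ((hg n).2 x))// -ler_pdivlMr//.
rewrite ltW//; near: n; exact: (near_infty_natSinv_lt (PosNum (divr_gt0 e_gt0 S0))).
Unshelve. all: by end_near. Qed.

Lemma dist_integral_gaussian_vector (f g : 'rV[R]_k -> R) (M e : R) :
  continuous f -> (forall x, `|f x| <= M) -> trig_poly g ->
  (forall x, `|g x - f x| <= e * (1 + \sum_i x 0 i ^+ 2)) ->
  `|\int[P]_w g (\row_j Y j w) - \int[P]_w f (\row_j Y j w)| <=
  e * (1 + \sum_i C i i).
Proof.
move=> cf fM tg gf.
have mf := measurable_continuous_gaussian_vector cf fM.
have ig := trig_poly_gaussian_vector tg.
have iF : P.-integrable setT (fun w => (f (\row_j Y j w))%:E).
  apply: measurable_bounded_integrable => //.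
    exact: fin_num_fun_lty.
  by exists M; split => [|x /ltW Mx w _ /=]; [exact: num_real|exact: le_trans Mx].
have iB : P.-integrable setT
    (fun w => (g (\row_j Y j w) - f (\row_j Y j w))%:E).
  exact: (integrableB measurableT ig iF).
rewrite -RintegralB//.
apply: (le_trans (le_normr_Rintegral _ _)) => //.
have i2 i : P.-integrable setT (fun w => (Y i w ^+ 2)%:E).
  exact: integrable_sqr_gaussian_vector.
have i3 : P.-integrable setT (fun w => 1 + \sum_i (Y i w ^+ 2)%:E)%E.
  apply: integrableD => //; last exact: integrable_sum.
  exact: finite_measure_integrable_cst.
have SE : (fun w => (e * (1 + \sum_i Y i w ^+ 2))%:E) =
    (fun w => e%:E * (1 + \sum_i (Y i w ^+ 2)%:E))%E.
  by apply/funext => w; rewrite sumEFin -EFinD -EFinM.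
have iS : P.-integrable setT (fun w => (e * (1 + \sum_i Y i w ^+ 2))%:E).
  by rewrite SE; exact: integrableZl.
apply: (@le_trans _ _ (\int[P]_w (e * (1 + \sum_i Y i w ^+ 2)))).
  apply: le_Rintegral => //.
    exact: (integrable_abse iB).
  move=> w _; apply: (le_trans (gf _)).
  by under eq_bigr do rewrite mxE.
case: hY => _ _ _ EYY.
rewrite le_eqVlt; apply/orP; left; apply/eqP.
rewrite /Rintegral SE integralZl// integralD//=; first last.
- exact: integrable_sum.
- exact: finite_measure_integrable_cst.
rewrite integral_cst//= probability_setT mule1 integral_sum//=.
rewrite (eq_bigr (fun i => (C i i)%:E)) => [|i _]; last by rewrite -EYY.
by rewrite sumEFin.
Qed.

End Moments.

(** [Psi] depends on [g] alone, not on the probability space, so it serves the approximating vectors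
    and their limit alike. Its continuity is entrywise, along any filter. *)
Lemma trig_poly_cov (g : 'rV[R]_k -> R) : trig_poly g ->
  exists2 Psi : ('I_k -> 'I_k -> R) -> R,
    (forall (I : Type) (F : set_system I) (C : I -> 'I_k -> 'I_k -> R) C0,
      Filter F -> (forall i j, C e i j @[e --> F] --> C0 i j) ->
      Psi (C e) @[e --> F] --> Psi C0) &
    forall d (T : measurableType d) (P : probability T R) Y C,
      centered_gaussian_vector P Y C ->
      \int[P]_w g (\row_j Y j w) = Psi C.
Proof.
elim=> [a b c|g1 g2 tg1 [Psi1 c1 h1] tg2 [Psi2 c2 h2]].
  exists (fun C => a * gaussian_cos b (quad_form c C)).
    move=> I F C C0 FF CC0; apply: cvgM; first exact: cvg_cst.
    apply: (cvg_comp (fun e => quad_form c (C e)) (gaussian_cos b)); last exact: continuous_gaussian_cos.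
    apply: cvg_sumr => i; apply: cvg_sumr => j.
    by apply: cvgM; [exact: cvg_cst|exact: CC0].
  move=> d T P Y C hY.
  have mS : measurable_fun setT (fun w => b + \sum_j c j * Y j w).
    by apply: measurable_funD => //; exact: (measurable_sum_gaussian_vector hY).
  rewrite (_ : (fun w => _) = fun w => a * cos (b + \sum_j c j * Y j w)); last first.
    by apply/funext => w; do 3 congr (_ _); apply: eq_bigr => j _; rewrite mxE.
  rewrite RintegralZl//; last exact: integrable_cos.
  by congr (_ * _); rewrite /Rintegral (integral_cos_gaussian_vector hY).
exists (fun C => Psi1 C + Psi2 C).
  by move=> I F C C0 FF CC0; apply: cvgD; [exact: c1|exact: c2].
move=> d T P Y C hY.
by rewrite RintegralD//; [rewrite (h1 _ _ _ _ _ hY) (h2 _ _ _ _ _ hY)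
  |exact: (trig_poly_gaussian_vector hY)|exact: (trig_poly_gaussian_vector hY)].
Qed.

(** Three errors of at most [eps / 4] each: replacing [f] by [g] at [Y e], passing from [Psi (C e)]
    to [Psi C0], and returning from [g] to [f] at [Z]. *)
Lemma gaussian_vector_cvg (I : Type) (F : set_system I) {FF : Filter F}
    d (T : measurableType d) (P : probability T R)
    d' (T' : measurableType d') (P' : probability T' R)
    (Y : I -> 'I_k -> T -> R) (Z : 'I_k -> T' -> R) (C : I -> 'I_k -> 'I_k -> R) C0
    (f : 'rV[R]_k -> R) :
  (forall e, centered_gaussian_vector P (Y e) (C e)) ->
  centered_gaussian_vector P' Z C0 ->
  (forall i j, C e i j @[e --> F] --> C0 i j) ->
  continuous f -> bounded_fun f ->
  ('E_P[fun w => f (\row_j Y e j w)] @[e --> F] -->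
   'E_P'[fun w => f (\row_j Z j w)])%E.
Proof.
move=> hY hZ CC0 cf [M0 [_ hM0]].
pose M := M0 + 1.
have fM x : `|f x| <= M by apply: (hM0 M) => //; rewrite ltrDl.
have iE d1 (S : measurableType d1) (Q : probability S R) W D :
    centered_gaussian_vector Q W D ->
    ('E_Q[fun w => f (\row_j W j w)] = (\int[Q]_w f (\row_j W j w))%:E)%E.
  move=> hW; rewrite unlock fineK//; apply: integrable_fin_num => //.
  apply: measurable_bounded_integrable => //.
  - exact: fin_num_fun_lty.
  - exact: (measurable_continuous_gaussian_vector hW cf fM).
  - by exists M; split => [|x /ltW Mx w _ /=]; [exact: num_real|exact: le_trans Mx].
rewrite (iE _ _ _ _ _ hZ); under eq_fun do rewrite (iE _ _ _ _ _ (hY _)).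
apply: cvg_EFin; first by near=> e.
apply/cvgrPdist_le => eps eps0.
pose S0 := 1 + \sum_i C0 i i.
have SZ : 0 <= \sum_i C0 i i.
  apply: sumr_ge0 => i _; rewrite -lee_fin; case: hZ => _ _ _ <-.
  by apply: integral_ge0 => w _; rewrite lee_fin -expr2 sqr_ge0.
have S0_gt0 : 0 < S0 by rewrite ltr_wpDr.
(* The extra 1 leaves room for the trace of [C e], which eventually exceeds that of [C0] by at most
   1. *)
pose del := eps / (4 * (S0 + 1)).
have S1 : 0 < S0 + 1 by rewrite addr_gt0.
have del0 : 0 < del by rewrite divr_gt0// mulr_gt0.
have [g tg gf] := trig_poly_approx cf fM del0.
have [Psi cPsi hPsi] := trig_poly_cov tg.
have /cvgrPdist_le h1 := cPsi _ _ _ _ FF CC0.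
have h2 : \sum_i C e i i @[e --> F] --> \sum_i C0 i i.
  by apply: cvg_sumr => i; exact: CC0.
have eps2 : 0 < eps / 4 by rewrite divr_gt0.
near=> e.
have d1 : `|Psi C0 - Psi (C e)| <= eps / 4 by near: e; exact: h1.
have d2 : `|\sum_i C0 i i - \sum_i C e i i| <= 1.
  by near: e; move/cvgrPdist_le : h2; exact.
have := dist_integral_gaussian_vector hZ cf fM tg gf.
have := dist_integral_gaussian_vector (hY e) cf fM tg gf.
rewrite (hPsi _ _ _ _ _ hZ) (hPsi _ _ _ _ _ (hY e)).
set A := Rintegral _ _ _; set B := Rintegral _ _ _ => hA hB.
have dE : del * (S0 + 1) = eps / 4 by rewrite /del; field; rewrite gt_eqF.
have hA' : `|Psi (C e) - A| <= eps / 4.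
  rewrite (le_trans hA)// -dE; apply: (ler_wpM2l (ltW del0)); rewrite /S0.
  by move: d2; rewrite ler_norml => /andP[? ?]; lra.
have hB' : `|Psi C0 - B| <= eps / 4.
  by rewrite (le_trans hB)// -dE; apply: (ler_wpM2l (ltW del0)); rewrite lerDl.
rewrite -[(fine \o _) e]/A; move: d1 hA' hB'; rewrite !ler_norml => /andP[? ?] /andP[? ?] /andP[? ?].
by apply/andP; split; lra.
Unshelve. all: by end_near. Qed.

End GaussianVector.
(** * Sheets and their increments *)

Section SheetVectors.
Context {R : realType} {n : nat} {d : measure_display} {T : measurableType d}
  (P : probability T R).
Implicit Types X : 'rV[R]_n -> {RV P >-> R}.

Lemma gaussian_field_vector X (K : 'rV[R]_n -> 'rV[R]_n -> R) :
  gaussian_field X -> centered X ->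
  (forall s s', 'E_P[fun w => (X s w * X s' w)%R] = (K s s')%:E)%E ->
  forall m (q : 'I_m -> 'rV[R]_n),
  centered_gaussian_vector P (fun i w => X (q i) w) (fun i j => K (q i) (q j)).
Proof.
move=> gX cX covX m q; split.
- by move=> j; exact: measurable_funPT.
- by move=> c; exact: gX.
- by move=> j; have := cX (q j); rewrite unlock.
- by move=> i j; have := covX (q i) (q j); rewrite unlock.
Qed.

(** Made for increments, which are combinations of field values over the vertices [J] of a box; the
    covariance follows by bilinearity. *)
Lemma gaussian_field_sum_vector X K (J : finType) m (c : 'I_m -> J -> R)
    (q : 'I_m -> J -> 'rV[R]_n) :
  gaussian_field X -> centered X ->
  (forall s s', 'E_P[fun w => (X s w * X s' w)%R] = (K s s')%:E)%E ->
  centered_gaussian_vector P (fun i w => \sum_a c i a * X (q i a) w)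
    (fun i j => \sum_a \sum_b c i a * c j b * K (q i a) (q j b)).
Proof.
move=> gX cX covX.
have iX s : P.-integrable setT (fun w => (X s w)%:E).
  exact: (integrable_gaussian_vector
    (gaussian_field_vector gX cX covX (fun _ : 'I_1 => s)) ord0).
have iXX s s' : P.-integrable setT (fun w => (X s w * X s' w)%:E).
  exact: (integrable_mul_gaussian_vector (gaussian_field_vector gX cX covX
    (fun i : 'I_2 => if i == ord0 then s else s')) ord0 ord_max).
split.
- by move=> j; apply: measurable_sum => a; apply: measurable_funM.
- move=> e.
  (* A combination of combinations is flattened into one sum over an ordinal, the index type that
     [gaussian_field] takes. *)
  rewrite (_ : (fun w => _) = fun w => \sum_(l < #|{: 'I_m * J}|)
      (e (enum_val l).1 * c (enum_val l).1 (enum_val l).2) *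
      X (q (enum_val l).1 (enum_val l).2) w); first exact: gX.
  apply/funext => w.
  rewrite -(big_enum_val (fun z : 'I_m * J => e z.1 * c z.1 z.2 * X (q z.1 z.2) w)).
  rewrite (eq_bigl xpredT)// -(pair_bigA _ (fun i a => e i * c i a * X (q i a) w))/=.
  by apply: eq_bigr => i _; rewrite mulr_sumr; apply: eq_bigr => a _; rewrite mulrA.
- move=> j; under eq_integral do rewrite -sumEFin.
  rewrite integral_sum//= => [|a].
    rewrite big1// => a _; under eq_integral do rewrite EFinM.
    by rewrite integralZl//; have := cX (q j a); rewrite unlock => ->; rewrite mule0.
  by under eq_fun do rewrite EFinM; exact: integrableZl.
- move=> i j.
  have iab a b : P.-integrable setT
      (fun w => (c i a * c j b)%:E * (X (q i a) w * X (q j b) w)%:E)%E.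
    by apply: integrableZl => //; exact: iXX.
  transitivity (\int[P]_w \sum_a \sum_b
      ((c i a * c j b)%:E * (X (q i a) w * X (q j b) w)%:E))%E.
    apply: eq_integral => w _; rewrite mulr_suml -sumEFin.
    apply: eq_bigr => a _; rewrite mulr_sumr -sumEFin.
    by apply: eq_bigr => b _; rewrite -EFinM mulrACA.
  rewrite integral_sum//= => [|a]; last exact: integrable_sum.
  rewrite -sumEFin; apply: eq_bigr => a _; rewrite integral_sum//= -sumEFin.
  apply: eq_bigr => b _; rewrite (integralZl measurableT (iXX _ _)).
  by have := covX (q i a) (q j b); rewrite unlock EFinM => ->.
Qed.

End SheetVectors.

(** * Signs and vertices of a box *)

Section Increments.
Context {R : realType} {n : nat}.
Implicit Types (t u v eps : 'rV[R]_n).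

Definition vertex t u (s : {ffun 'I_n -> bool}) : 'rV[R]_n :=
  t + \sum_(i < n) ((s i)%:R * u 0 i) *: unit_vector i.

Lemma vertexE t u s i : vertex t u s 0 i = t 0 i + (s i)%:R * u 0 i.
Proof.
rewrite mxE summxE (bigD1 i)//= big1 => [|j ji].
  by rewrite addr0 !mxE !eqxx mulr1.
by rewrite !mxE eqxx eq_sym (negbTE ji) mulr0.
Qed.

Lemma coord_scaleE eps u i : coord_scale eps u 0 i = eps 0 i * u 0 i.
Proof.
rewrite summxE (bigD1 i)//= big1 => [|j ji].
  by rewrite addr0 !mxE !eqxx mulr1.
by rewrite !mxE eqxx eq_sym (negbTE ji) mulr0.
Qed.

(** The exponent counts the coordinates where [s] is false; the sum of the [s i] is at most [n], so
    the natural subtraction does not truncate. *)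
Lemma sign_vertex (s : {ffun 'I_n -> bool}) :
  (-1) ^+ (n - \sum_(i < n) s i) = \prod_(i < n) (-1) ^+ (~~ s i) :> R.
Proof.
rewrite -expr_sum; congr (_ ^+ _).
have h : (n = \sum_(i < n) s i + \sum_(i < n) ~~ s i)%N.
  rewrite -big_split/= (eq_bigr (fun=> 1%N)) => [|i _]; last by case: (s i).
  by rewrite sum_nat_const card_ord muln1.
by rewrite {1}h addKn.
Qed.

Lemma total_incrementE u (f : 'rV[R]_n -> R) t :
  total_increment u f t =
  \sum_(s : {ffun 'I_n -> bool}) (\prod_(i < n) (-1) ^+ (~~ s i)) * f (vertex t u s).
Proof. by apply: eq_bigr => s _; rewrite sign_vertex. Qed.

(** Each term is a product over [i] of a factor depending only on [s i] and [s' i], so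
    distributivity, applied twice, turns the sums into a product of four-term sums. The base point
    [t] cancels in the differences. *)
Lemma sum_vertex_prod (kap : 'I_n -> R -> R) t u v :
  \sum_(s : {ffun 'I_n -> bool}) \sum_(s' : {ffun 'I_n -> bool})
    (\prod_i (-1) ^+ (~~ s i)) * (\prod_i (-1) ^+ (~~ s' i)) *
    \prod_i kap i (vertex t u s 0 i - vertex t v s' 0 i) =
  \prod_i (kap i (u 0 i - v 0 i) - kap i (u 0 i) - kap i (- v 0 i) + kap i 0).
Proof.
pose F i (a b : bool) : R := (-1) ^+ (~~ a) * (-1) ^+ (~~ b) *
  kap i (a%:R * u 0 i - b%:R * v 0 i).
transitivity (\sum_(s : {ffun 'I_n -> bool}) \sum_(s' : {ffun 'I_n -> bool})
    \prod_i F i (s i) (s' i)).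
  apply: eq_bigr => s _; apply: eq_bigr => s' _.
  rewrite -!big_split/=; apply: eq_bigr => i _; rewrite !vertexE /F.
  by congr (_ * kap i _); ring.
transitivity (\sum_(s : {ffun 'I_n -> bool}) \prod_i \sum_b F i (s i) b).
  by apply: eq_bigr => s _; rewrite (bigA_distr_bigA (fun i b => F i (s i) b)).
rewrite -(bigA_distr_bigA (fun i a => \sum_b F i a b)).
apply: eq_bigr => i _; rewrite !big_bool /F/= !(expr0, expr1, mul1r, mul0r, subr0, sub0r).
by ring.
Qed.

End Increments.

(** * One-dimensional limits *)

Section Limits.
Context {R : realType}.

(** Up to sign, the difference quotient at 1 of the power of exponent [- b], whose derivative there
    is [- b]. *)
Lemma powR_quotient_cvg (b : R) :
  (1 - (1 + h) `^ (- b)) / h @[h --> (0 : R)^'] --> b.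
Proof.
have [dp pE] := is_derive1_powR (- b) (@ltr01 R).
rewrite powR1 mulr1 in pE.
have : h^-1 *: ((h *: 1 + 1) `^ (- b) - 1 `^ (- b)) @[h --> (0 : R)^'] -->
    ('D_1 (fun x : R => x `^ (- b)) 1 : R).
  exact: dp.
rewrite pE.
move=> /cvgN; rewrite opprK => h1.
apply: cvg_trans h1; apply: near_eq_cvg; near=> h.
rewrite /= powR1 -[LHS]/(- (h^-1 * ((h * 1 + 1) `^ (- b) - 1))) mulr1.
by rewrite [h + 1]addrC -mulrN opprB mulrC.
Unshelve. all: by end_near. Qed.

(** Substitute [h = x]^ a * [|v|]^ a[in]powR_quotient_cvg[: the denominator is]x [^ a], that is, [h]
    divided by []|v| [^ a]. *)
Lemma cauchy_kernel_cvg (a b v : R) : 0 < a ->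
  (1 - (1 + `|x * v| `^ a) `^ (- b)) / (x `^ (a / 2)) ^+ 2 @[x --> 0^'+]
  --> b * `|v| `^ a.
Proof.
move=> a0.
have a2 (x : R) : 0 < x -> (x `^ (a / 2)) ^+ 2 = x `^ a.
  move=> x0; rewrite expr2 -powRD; first by rewrite -splitr.
  by rewrite (gt_eqF x0) implybT.
(* For [v = 0] the substituted [h] would be constantly 0, outside the punctured neighbourhood; the
   quotient itself is then 0. *)
have [->|v0] := eqVneq v 0.
  rewrite normr0 powR0 ?gt_eqF// mulr0.
  apply: (@cvg_trans _ (cst (0 : R) @ (0 : R)^'+)); last exact: cvg_cst.
  apply: near_eq_cvg; near=> x.
  by rewrite mulr0 normr0 powR0 ?gt_eqF// addr0 powR1 subrr mul0r.
pose c := `|v| `^ a.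
have c0 : 0 < c by rewrite powR_gt0// normr_gt0.
have hc : x `^ a * c @[x --> (0 : R)^'+] --> (0 : R)^'.
  have h0 : x `^ a * c @[x --> (0 : R)^'+] --> (0 : R).
    by rewrite -[X in _ --> X](mul0r c); apply: cvgM; [exact: powR_cvg0|exact: cvg_cst].
  move=> A /= hA; have := h0 _ hA.
  rewrite /= /nbhs/= => hA'; near=> x.
  have x0 : 0 < x by [].
  apply: (near hA' x) => //.
  by rewrite mulf_neq0 ?gt_eqF// powR_gt0.
have h1 : (1 - (1 + x `^ a * c) `^ (- b)) / (x `^ a * c) * c
    @[x --> (0 : R)^'+] --> b * c.
  apply: cvgM; last exact: cvg_cst.
  exact: (cvg_comp _ _ hc (@powR_quotient_cvg b)).
apply: cvg_trans h1; apply: near_eq_cvg; near=> x.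
have x0 : 0 < x by [].
rewrite /= normrM (gtr0_norm x0) powRM ?normr_ge0 ?ltW// a2// -/c.
by field; rewrite !gt_eqF// powR_gt0.
Unshelve. all: by end_near. Qed.

Lemma zero_right_coord n (i : 'I_n) :
  (fun eps : 'rV[R]_n => eps 0 i) @ zero_right --> (0 : R)^'+.
Proof.
move=> A hA.
have hc : (fun eps : 'rV[R]_n => eps 0 i) @ nbhs (0 : 'rV[R]_n) --> (0 : R).
  by have := @coord_continuous R 1 n 0 i 0; rewrite /continuous_at mxE.
have h0 : nbhs (0 : 'rV[R]_n) [set eps | 0 < eps 0 i -> A (eps 0 i)].
  exact: (hc _ hA).
suff : nbhs (0 : 'rV[R]_n) [set eps | (forall j, 0 < eps 0 j) -> A (eps 0 i)].
  by [].
by apply: filterS h0 => eps h pos; exact: h (pos i).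
Qed.

End Limits.

(** * Covariances of the normalised increments *)

Section CauchySheet.
Context {R : realType} {n : nat} (alpha beta : 'I_n -> R)
  {d : measure_display} {T : measurableType d} (P : probability T R).

Definition cauchy_kernel i (z : R) : R := (1 + `|z| `^ alpha i) `^ (- beta i).

(** The signs divided by the normalisation are the coefficients of a combination of field values,
    and [sum_vertex_prod] factorises the covariance. It covers every [eps]: if the normalisation is
    0, the convention for inverting 0 makes both vector and covariance vanish. *)
Lemma cauchy_increment_vector (X : 'rV[R]_n -> {RV P >-> R}) t eps m
    (u : 'I_m -> 'rV[R]_n) : cauchy_sheet alpha beta X ->
  centered_gaussian_vector P
    (fun j w => total_increment (coord_scale eps (u j)) (fun s => X s w) t
                / \prod_(i < n) eps 0 i `^ (alpha i / 2))
    (fun j j' => \prod_i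
      ((cauchy_kernel i (eps 0 i * u j 0 i - eps 0 i * u j' 0 i)
        - cauchy_kernel i (eps 0 i * u j 0 i)
        - cauchy_kernel i (- (eps 0 i * u j' 0 i)) + cauchy_kernel i 0)
       / (eps 0 i `^ (alpha i / 2)) ^+ 2)).
Proof.
move=> [gX cX covX].
pose K (s s' : 'rV[R]_n) := \prod_i cauchy_kernel i (s 0 i - s' 0 i).
have covK s s' : ('E_P[fun w => (X s w * X s' w)%R] = (K s s')%:E)%E.
  have := covX s' (s - s'); rewrite addrC subrK => ->.
  apply: (f_equal EFin); apply: eq_bigr => i _.
  by rewrite /cauchy_kernel !mxE.
pose D : R := \prod_(i < n) eps 0 i `^ (alpha i / 2).
pose c (j : 'I_m) (s : {ffun 'I_n -> bool}) : R :=
  (\prod_(i < n) (-1) ^+ (~~ s i)) / D.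
have := gaussian_field_sum_vector c
  (fun j => vertex t (coord_scale eps (u j))) gX cX covK.
congr (centered_gaussian_vector P _ _).
  apply/funext => j; apply/funext => w; rewrite total_incrementE mulr_suml.
  by apply: eq_bigr => s _; rewrite /c mulrAC.
apply/funext => j; apply/funext => j'; rewrite big_split/= prodfV.
under [in RHS]eq_bigr do rewrite -!coord_scaleE.
rewrite -(sum_vertex_prod _ t) mulr_suml; apply: eq_bigr => s _.
rewrite mulr_suml; apply: eq_bigr => s' _; rewrite /c /K.
rewrite prodrXl -/D [RHS]mulrAC; congr (_ * _).
by rewrite mulrACA -invfM -expr2.
Qed.

(** The kernel is even and equals 1 at 0, so with [k] for the kernel each numerator is
    [(1 - k u) + (1 - k v) - (1 - k (u - v))] at scaled arguments: three instances of
    [cauchy_kernel_cvg]. *)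
Lemma cauchy_increment_cov_cvg (u v : 'rV[R]_n) : (forall i, 0 < alpha i) ->
  \prod_i
    ((cauchy_kernel i (eps 0 i * u 0 i - eps 0 i * v 0 i)
      - cauchy_kernel i (eps 0 i * u 0 i)
      - cauchy_kernel i (- (eps 0 i * v 0 i)) + cauchy_kernel i 0)
     / (eps 0 i `^ (alpha i / 2)) ^+ 2) @[eps --> zero_right] -->
  \prod_i (beta i * (`|u 0 i| `^ alpha i + `|v 0 i| `^ alpha i
                     - `|u 0 i - v 0 i| `^ alpha i)).
Proof.
move=> alpha0; apply: cvg_prodr => i.
apply: (cvg_comp (fun eps : 'rV[R]_n => eps 0 i) (fun x : R =>
    (cauchy_kernel i (x * u 0 i - x * v 0 i) - cauchy_kernel i (x * u 0 i)
     - cauchy_kernel i (- (x * v 0 i)) + cauchy_kernel i 0)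
    / (x `^ (alpha i / 2)) ^+ 2)); first exact: zero_right_coord.
have hk w := @cauchy_kernel_cvg R _ (beta i) w (alpha0 i).
rewrite mulrBr mulrDr.
pose q w (x : R) : R :=
  (1 - (1 + `|x * w| `^ alpha i) `^ (- beta i)) / (x `^ (alpha i / 2)) ^+ 2.
rewrite (_ : (fun x => _) =
    (fun x => q (u 0 i) x + q (v 0 i) x - q (u 0 i - v 0 i) x)); last first.
  apply/funext => x; rewrite /q -mulrDl -mulrBl; congr (_ / _).
  rewrite /cauchy_kernel normrN normr0 powR0 ?gt_eqF// addr0 powR1 -mulrBr.
  have e (a b c : R) : a - b - c + 1 = 1 - b + (1 - c) - (1 - a) by ring.
  exact: e.
by apply: cvgB; [apply: cvgD|]; exact: hk.
Qed.

End CauchySheet.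

Lemma scaled_sheet_vector {R : realType} {n : nat} (alpha : 'I_n -> R)
    {d : measure_display} {T : measurableType d} (P : probability T R)
    (B : 'rV[R]_n -> {RV P >-> R}) (a : R) m (u : 'I_m -> 'rV[R]_n) :
  fractional_brownian_sheet alpha B ->
  centered_gaussian_vector P (fun j w => a * B (u j) w)
    (fun j j' => a ^+ 2 * ((2 ^+ n)^-1 *
      \prod_(i < n) (`|u j 0 i| `^ alpha i + `|u j' 0 i| `^ alpha i
                     - `|u j 0 i - u j' 0 i| `^ alpha i))).
Proof.
move=> [gB cB covB].
(* A multiple of one field value is a combination with a single term. *)
have := gaussian_field_sum_vector (fun (_ : 'I_m) (_ : 'I_1) => a)
  (fun j _ => u j) gB cB covB.
congr (centered_gaussian_vector P _ _).
  by apply/funext => j; apply/funext => w; rewrite big_ord1.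
by apply/funext => j; apply/funext => j'; rewrite !big_ord1 expr2.
Qed.

Theorem proposition4p5 (R : realType) (n : nat) (hn : (1 <= n)%N)
  (alpha beta : 'I_n -> R)
  (halpha : forall i, 0 < alpha i <= 2) (hbeta : forall i, 0 < beta i)
  (d : measure_display) (T : measurableType d) (P : probability T R)
  (X : 'rV[R]_n -> {RV P >-> R}) (hX : cauchy_sheet alpha beta X)
  (d' : measure_display) (T' : measurableType d') (P' : probability T' R)
  (B : 'rV[R]_n -> {RV P' >-> R}) (hB : fractional_brownian_sheet alpha B)
  (t : 'rV[R]_n) :
  cvg_fdd P P' zero_right
    (fun (eps u : 'rV[R]_n) (w : T) =>
       total_increment (coord_scale eps u) (fun s => X s w) t
       / \prod_(i < n) eps 0 i `^ (alpha i / 2))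
    (fun (u : 'rV[R]_n) (w : T') =>
       (\prod_(i < n) Num.sqrt (2 * beta i)) * B u w).
Proof.
move=> k u f cf bf.
have FF : Filter (@zero_right R n) by exact: within_filter.
apply: (gaussian_vector_cvg
  (fun eps => cauchy_increment_vector t eps u hX)
  (scaled_sheet_vector _ u hB) _ cf bf) => j j'.
(* The constants are spread over the coordinates: each receives the square of
   [Num.sqrt (2 * beta i)] times one half, which is [beta i]. *)
have h2 : (2 ^+ n : R)^-1 = \prod_(i < n) 2^-1.
  by rewrite prodr_const card_ord exprVn.
rewrite -prodrXl h2 -!big_split/=.
rewrite (eq_bigr (fun i => beta i * (`|u j 0 i| `^ alpha i +
    `|u j' 0 i| `^ alpha i - `|u j 0 i - u j' 0 i| `^ alpha i))) => [|i _].
  by apply: cauchy_increment_cov_cvg => i; case/andP: (halpha i).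
rewrite sqr_sqrtr ?mulr_ge0 ?ltW// mulrA; congr (_ * _).
by rewrite mulrC mulKf.
Qed.
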